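(* Assume that for every $i\in\mathcal{M}$, $$r\mathbf{I}_n-[A(i)+A^{\top}(i)+C^{\top}(i)C(i)]>0,\qquad r\mathbf{I}_n-[A(i)+A^{\top}(i)+\widehat{A}(i)+\widehat{A}^{\top}(i)]>0,$$ and $$Q(i)\ge0,\qquad \widehat{Q}(i)\ge0,\qquad R(i)>0 .$$ Let $P=(P(1),\ldots,P(M))\in\mathcal{M}(\mathbb{S}^n_+)$ be a solution of $$ \left\{ \begin{aligned} rP(i)=\;&P(i)A(i)+A^{\top}(i)P(i)+C^{\top}(i)P(i)C(i)+Q(i)-S^{\top}(i)\widetilde{R}^{-1}(i)S(i)+\sum_{j\in\mathcal{M}}\lambda_{ij}P(j),\\ \widetilde{R}(i)=\;&R(i)+D^{\top}(i)P(i)D(i)>0, \end{aligned} \right.\qquad i\in\mathcal{M}, $$ where $S(i)=B^{\top}(i)P(i)+D^{\top}(i)P(i)C(i)$. Then the system of algebraic Riccati equations $$ r\widetilde{P}(i)=\widetilde{P}(i)\widetilde{A}(i)+\widetilde{A}^{\top}(i)\widetilde{P}(i)+\widetilde{C}^{\top}(i)P(i)\widetilde{C}(i)+\widetilde{Q}(i)-\widetilde{S}^{\top}(i)\widetilde{R}^{-1}(i)\widetilde{S}(i)+\sum_{j\in\mathcal{M}}\lambda_{ij}\widetilde{P}(j),\qquad i\in\mathcal{M}, $$ where $\widetilde{A}=A+\widehat{A}$, $\widetilde{C}=C+\widehat{C}$, $\widetilde{Q}=Q+\widehat{Q}$ and $\widetilde{S}(i)=B^{\top}(i)\widetilde{P}(i)+D^{\top}(i)P(i)\widetilde{C}(i)$,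 admits a solution $\widetilde{P}=(\widetilde{P}(1),\ldots,\widetilde{P}(M))\in\mathcal{M}(\mathbb{S}^n_+)$.
   Context: $\mathcal{M}=\{1,\ldots,M\}$ is a finite set and $(\lambda_{ij})_{i,j\in\mathcal{M}}$ is the generator of a continuous-time Markov chain on $\mathcal{M}$: $\lambda_{ij}\ge0$ for $i\ne j$ and $\sum_{j\in\mathcal{M}}\lambda_{ij}=0$ for each $i$. $r>0$ is a constant. For each $i\in\mathcal{M}$, $A(i),\widehat{A}(i),C(i),\widehat{C}(i)\in\mathbb{R}^{n\times n}$ and $B(i),D(i)\in\mathbb{R}^{n\times k}$ are constant matrices, and $Q(i),\widehat{Q}(i)\in\mathbb{R}^{n\times n}$, $R(i)\in\mathbb{R}^{k\times k}$ are constant symmetric matrices. For a symmetric matrix $G$, $G\ge0$ (resp. $G>0$) means positive semi-definite (resp. positive definite); $\mathbf{I}_n$ is the identity matrix. $\mathbb{S}^n_+$ is the set of $n\times n$ symmetric positive semi-definite real matrices, and $\mathcal{M}(\mathbb{S}^n_+)$ is the set of tuples $P=(P(1),\ldots,P(M))$ with $P(i)\in\mathbb{S}^n_+$ for all $i\in\mathcal{M}$. *)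

(* Defs.v *)
From HB Require Import structures.
From mathcomp Require Import all_boot all_order all_algebra.
From mathcomp Require Import reals.
Set Implicit Arguments.
Unset Strict Implicit.
Unset Printing Implicit Defensive.
Import Order.TTheory GRing.Theory Num.Theory.
Local Open Scope ring_scope.

(* [G >= 0] and [G > 0]; symmetry of G is part of both predicates. *)
Definition psdmx (R : realType) (n : nat) (G : 'M[R]_n) : Prop :=
  G \is symmetricmx /\ forall x : 'cV[R]_n, 0 <= (x^T *m G *m x) 0 0.

Definition pdmx (R : realType) (n : nat) (G : 'M[R]_n) : Prop :=
  G \is symmetricmx /\
  forall x : 'cV[R]_n, x != 0 -> 0 < (x^T *m G *m x) 0 0.

Definition is_generator (R : realType) (M : nat) (lam : 'M[R]_M) : Prop :=
  (forall i j : 'I_M, i != j -> 0 <= lam i j) /\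
  (forall i : 'I_M, \sum_(j < M) lam i j = 0).

Section Riccati.
Variables (R : realType) (M n k : nat) (r : R) (lam : 'M[R]_M).
Implicit Types (A C Q At Ct Qt P Pt : 'I_M -> 'M[R]_n) (B D : 'I_M -> 'M[R]_(n, k)).
Implicit Types (Rw : 'I_M -> 'M[R]_k).

Definition Rtilde D Rw P (i : 'I_M) : 'M[R]_k :=
  Rw i + (D i)^T *m P i *m D i.

(* B^T X + D^T P C. The matrix S(i) of the first system is the case X = P;
   the matrix S~(i) of the second one is the case X = P~, C = C~. *)
Definition Smx B C D P (X : 'I_M -> 'M[R]_n) (i : 'I_M) : 'M[R]_(k, n) :=
  (B i)^T *m X i + (D i)^T *m P i *m C i.

Definition riccati_system A C Q B D Rw P : Prop :=
  forall i : 'I_M,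
    r *: P i =
      P i *m A i + (A i)^T *m P i + (C i)^T *m P i *m C i + Q i
      - (Smx B C D P P i)^T *m invmx (Rtilde D Rw P i) *m Smx B C D P P i
      + \sum_(j < M) lam i j *: P j
    /\ pdmx (Rtilde D Rw P i).

(* The second system, with unknown Pt and given P; the arguments At, Ct, Qt
   stand for A + A^, C + C^, Q + Q^. The term Ct^T P Ct involves P, not Pt. *)
Definition riccati_system_tilde At Ct Qt B D Rw P Pt : Prop :=
  forall i : 'I_M,
    r *: Pt i =
      Pt i *m At i + (At i)^T *m Pt i + (Ct i)^T *m P i *m Ct i + Qt i
      - (Smx B Ct D P Pt i)^T *m invmx (Rtilde D Rw P i) *m Smx B Ct D P Pt i
      + \sum_(j < M) lam i j *: Pt j.
End Riccati.

(* Main.v *)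
Require Import Defs.
From HB Require Import structures.
From mathcomp Require Import all_boot all_order all_algebra.
From mathcomp Require Import reals.
From mathcomp Require Import boolp classical_sets topology normedtype sequences.
From mathcomp Require Import ring lra.
Set Implicit Arguments.
Unset Strict Implicit.
Unset Printing Implicit Defensive.
Import Order.TTheory GRing.Theory Num.Theory.
Import numFieldNormedType.Exports.
Local Open Scope ring_scope.

(** With P fixed, the second system is the Riccati system of a discounted
linear-quadratic control problem, and it is solved by policy iteration.

For a feedback gain T, the cost of always using T is the solution X of the
linear system [bellman T X = 0]: a coupled Lyapunov system whose constant term
[cost T] is positive semi-definite, since P, Q~ and R are.  Completing the
square ([bellman_square]) shows that T |-> [bellman T X] is minimal at
T = [gain X] and that its minimum is the residual of X in the Riccati equation
([bellman_riccati]).  So X is a solution exactly when it is the cost of its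
own optimal gain, and one iterates: from X, compute the cost X' of [gain X].

Everything rests on a maximum principle for the Lyapunov operator
([lyap_psd]): if some positive definite Y has L(Y) < 0, then L(X) <= 0 implies
X >= 0.  Indeed, push X up to the boundary of the positive cone along Y; at the
boundary point Z = X + tY some Z(i) has a kernel vector x, on which only the
terms lambda_ij x^T Z(j) x, j <> i, of L(Z)(i) survive ([lyap_ker]).  They are
nonnegative, whereas x^T L(Z)(i) x < 0 if t > 0.  The principle makes L
injective, hence invertible ([lyap_solve]), and order preserving.

For the zero gain, the hypothesis r > A~ + A~^T says that Y = I is such a
certificate.  For later gains the current iterate X itself should be one, and
for this L(X) must be strictly negative while Q~ is only semi-definite.
Hence the cost is increased by e I, where e > 0 decreases to 0 along the
iteration: an iterate with [bellman (gain X) X] <= - e I is a certificate for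
its own gain ([supersolution_certificate]), the next iterate can be computed
with the smaller e', and the maximum principle gives 0 <= X' <= X
([policy_improvement]).  The iterates thus decrease and converge, and in the
limit e = 0 the gain is the one of the limit itself, which solves the Riccati
system. *)

(** * Quadratic forms *)

Section QuadraticForms.
Variable R : realType.
Implicit Types (n : nat).

Definition qf n (Z : 'M[R]_n) (x : 'cV[R]_n) : R := (x^T *m Z *m x) 0 0.

Lemma symmetricmxP n (Z : 'M[R]_n) : reflect (Z^T = Z) (Z \is symmetricmx).
Proof.
rewrite qualifE /= expr0 scale1r map_mx_id //.
by apply: (iffP eqP) => [{2}->|{1}<-].
Qed.

Lemma qf0 n (x : 'cV[R]_n) : qf 0 x = 0.
Proof. by rewrite /qf mulmx0 mul0mx mxE. Qed.

Lemma qfD n (Y Z : 'M[R]_n) x : qf (Y + Z) x = qf Y x + qf Z x.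
Proof. by rewrite /qf mulmxDr mulmxDl mxE. Qed.

Lemma qfN n (Z : 'M[R]_n) x : qf (- Z) x = - qf Z x.
Proof. by rewrite /qf mulmxN mulNmx mxE. Qed.

Lemma qfZ n a (Z : 'M[R]_n) x : qf (a *: Z) x = a * qf Z x.
Proof. by rewrite /qf -scalemxAr -scalemxAl mxE. Qed.

Lemma qf_sum n (I : finType) (Z : I -> 'M[R]_n) x :
  qf (\sum_i Z i) x = \sum_i qf (Z i) x.
Proof. by rewrite /qf mulmx_sumr mulmx_suml summxE. Qed.

Lemma qf_congr n m (Z : 'M[R]_n) (Y : 'M[R]_(n, m)) x :
  qf (Y^T *m Z *m Y) x = qf Z (Y *m x).
Proof. by rewrite /qf trmx_mul !mulmxA. Qed.

Lemma qf_scalar n a (x : 'cV[R]_n) : qf a%:M x = a * qf 1%:M x.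
Proof. by rewrite -qfZ scale_scalar_mx mulr1. Qed.

Lemma qf1E n (x : 'cV[R]_n) : qf 1%:M x = \sum_i x i 0 ^+ 2.
Proof.
by rewrite /qf mulmx1 mxE; apply: eq_bigr => i _; rewrite mxE expr2.
Qed.

Lemma qf1_gt0 n (x : 'cV[R]_n) : x != 0 -> 0 < qf 1%:M x.
Proof.
move=> x0; rewrite qf1E lt_def sumr_ge0 ?andbT => [|i _]; last exact: sqr_ge0.
apply: contraNneq x0 => /psumr_eq0P s0; apply/eqP/matrixP => i j.
rewrite ord1 mxE; apply/eqP; rewrite -sqrf_eq0; apply/eqP/s0 => // k _.
exact: sqr_ge0.
Qed.

Lemma qf1_ge0 n (x : 'cV[R]_n) : 0 <= qf 1%:M x.
Proof. by rewrite qf1E sumr_ge0 // => i _; rewrite sqr_ge0. Qed.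

Lemma qfDvec n (Z : 'M[R]_n) (x y : 'cV[R]_n) : Z \is symmetricmx ->
  qf Z (x + y) = qf Z x + 2 * (y^T *m Z *m x) 0 0 + qf Z y.
Proof.
move=> /symmetricmxP sZ; rewrite /qf [(x + y)^T]linearD /= !(mulmxDl, mulmxDr).
have add00 (U V : 'M[R]_1) : (U + V) 0 0 = U 0 0 + V 0 0 by rewrite mxE.
rewrite !add00.
have -> : (x^T *m Z *m y) 0 0 = (y^T *m Z *m x) 0 0.
  have <- : (y^T *m Z *m x)^T = x^T *m Z *m y.
    by rewrite !trmx_mul trmxK sZ mulmxA.
  by rewrite mxE.
by ring.
Qed.

Lemma qf_scalevec n (Z : 'M[R]_n) a x : qf Z (a *: x) = a ^+ 2 * qf Z x.
Proof.
by rewrite /qf [(a *: x)^T]linearZ /= -!scalemxAl -scalemxAr !mxE mulrA.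
Qed.

Lemma psdD n (Y Z : 'M[R]_n) : psdmx Y -> psdmx Z -> psdmx (Y + Z).
Proof.
move=> [/symmetricmxP sY pY] [/symmetricmxP sZ pZ]; split=> [|x].
  by apply/symmetricmxP; rewrite [LHS]linearD /= sY sZ.
by rewrite -/(qf _ _) qfD addr_ge0 //; [exact: pY | exact: pZ].
Qed.

Lemma psd_congr n m (Z : 'M[R]_n) (Y : 'M[R]_(n, m)) :
  psdmx Z -> psdmx (Y^T *m Z *m Y).
Proof.
move=> [/symmetricmxP sZ pZ]; split=> [|x].
  by apply/symmetricmxP; rewrite !trmx_mul trmxK sZ mulmxA.
by rewrite -/(qf _ _) qf_congr; exact: pZ.
Qed.

Lemma psd_scalar n a : 0 <= a -> psdmx (a%:M : 'M[R]_n).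
Proof.
move=> a0; split=> [|x]; first by apply/symmetricmxP; rewrite tr_scalar_mx.
by rewrite -/(qf _ _) qf_scalar mulr_ge0 // qf1_ge0.
Qed.

Lemma psd_cauchy_schwarz n (Z : 'M[R]_n) (x y : 'cV[R]_n) : psdmx Z ->
  ((y^T *m Z *m x) 0 0) ^+ 2 <= qf Z x * qf Z y.
Proof.
case=> sZ pZ; set b := (_ *m x) 0 0.
have h t : 0 <= qf Z x + 2 * (t * b) + t ^+ 2 * qf Z y.
  have := pZ (x + t *: y); rewrite -/(qf _ _) qfDvec // qf_scalevec.
  by rewrite [(t *: y)^T]linearZ /= -!scalemxAl mxE.
have a0 : 0 <= qf Z x by exact: pZ.
have c0 : 0 <= qf Z y by exact: pZ.
have [c_eq0|cn0] := eqVneq (qf Z y) 0; last first.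
  have c_gt0 : 0 < qf Z y by rewrite lt_def cn0.
  rewrite -subr_ge0; have -> : qf Z x * qf Z y - b ^+ 2 = qf Z y *
      (qf Z x + 2 * (- b / qf Z y * b) + (- b / qf Z y) ^+ 2 * qf Z y) by field.
  exact: mulr_ge0.
(* a form constant along y forces the affine function t |-> h t to be flat *)
have [->|bn0] := eqVneq b 0; first by rewrite expr0n /= mulr_ge0.
have := h (- (qf Z x + 1) / (2 * b)); rewrite c_eq0 mulr0 addr0.
have -> : qf Z x + 2 * (- (qf Z x + 1) / (2 * b) * b) = -1 by field.
by rewrite oppr_ge0 ler10.
Qed.

(** Cauchy-Schwarz applied to x and y = Z x: the square of y^T Z x = |Z x|^2
is at most qf Z x * qf Z y = 0. *)
Lemma psd_ker n (Z : 'M[R]_n) x : psdmx Z -> qf Z x = 0 -> Z *m x = 0.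
Proof.
move=> pZ Zx0; apply/eqP; apply: contraT => /qf1_gt0.
have := psd_cauchy_schwarz x (Z *m x) pZ; rewrite Zx0 mul0r => le0.
have := le_anti (introT andP (conj le0 (sqr_ge0 _))) => /eqP.
by rewrite sqrf_eq0 -mulmxA /qf mulmx1 => /eqP ->; rewrite ltxx.
Qed.

Lemma pd_psd n (Z : 'M[R]_n) : pdmx Z -> psdmx Z.
Proof.
case=> sZ pZ; split=> // x; have [->|/pZ /ltW //] := eqVneq x 0.
by rewrite mulmx0 mxE.
Qed.

Lemma pd_unit n (Z : 'M[R]_n) : pdmx Z -> Z \in unitmx.
Proof.
case=> /symmetricmxP sZ pZ; rewrite unitmxE unitfE.
apply/det0P => -[v v0 vZ]; have := pZ v^T.
rewrite -(inj_eq trmx_inj) trmxK trmx0 => /(_ v0).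
by rewrite vZ mul0mx mxE ltxx.
Qed.

Lemma qf_bounded n (W : 'M[R]_n) :
  exists2 K, 0 <= K & forall x, qf W x <= K * qf 1%:M x.
Proof.
exists (\sum_j \sum_i `|W i j|) => [|x].
  by do 2!apply: sumr_ge0 => ? _.
rewrite {1}/qf mxE mulr_suml.
apply: ler_sum => j _; rewrite mxE !mulr_suml; apply: ler_sum => i _.
have sq k : x k 0 ^+ 2 <= qf 1%:M x.
  by rewrite qf1E (bigD1 k) //= lerDl sumr_ge0 // => l _; exact: sqr_ge0.
have := sq i; have := sq j; rewrite mxE.
set u := x i 0; set v := x j 0; set s := qf _ _ => v2 u2.
apply: le_trans (ler_norm _) _.
rewrite mulrAC mulrC !normrM ler_wpM2l // -normrM ler_norml.
by apply/andP; split; nra.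
Qed.

(** By Cauchy-Schwarz with y = Z^-1 x, one has
|x|^4 = (y^T Z x)^2 <= (x^T Z x) (x^T Z^-1 x), and the last factor is at most
K |x|^2.  This avoids compactness of the unit sphere. *)
Lemma pd_coercive n (Z : 'M[R]_n) : pdmx Z ->
  exists2 K, 0 <= K & forall x, qf 1%:M x <= K * qf Z x.
Proof.
move=> pZ; have uZ := pd_unit pZ; have [K K0 hK] := qf_bounded (invmx Z).
have [/symmetricmxP sZ _] := pZ.
exists K => // x; have [->|/qf1_gt0 x0] := eqVneq x 0.
  by rewrite /qf !mulmx0 !mxE mulr0.
have yZ : (invmx Z *m x)^T *m Z = x^T.
  by rewrite -[in X in _ *m X]sZ -trmx_mul mulKVmx.
have := psd_cauchy_schwarz x (invmx Z *m x) (pd_psd pZ).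
have -> : qf Z (invmx Z *m x) = qf (invmx Z) x by rewrite /qf yZ mulmxA.
rewrite yZ -{1}[x^T]mulmx1 -/(qf _ _) => cs.
rewrite -(ler_pM2r x0) -expr2; apply: le_trans cs _.
rewrite mulrAC [leRHS]mulrC; apply: ler_wpM2l => //.
by have [_] := pd_psd pZ; apply.
Qed.

(** The constant is uniform in the mode i: this is what lets the whole tuple Z
move inside the positive cone at once. *)
Lemma qf_dominated n (I : finType) (Z W : I -> 'M[R]_n) :
  (forall i, pdmx (Z i)) ->
  exists2 K, 0 <= K & forall i x, qf (W i) x <= K * qf (Z i) x.
Proof.
move=> pZ.
have h i : exists K, 0 <= K /\ forall x, qf (W i) x <= K * qf (Z i) x.
  have [K K0 hK] := pd_coercive (pZ i); have [L L0 hL] := qf_bounded (W i).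
  exists (L * K); split=> [|x]; first exact: mulr_ge0.
  by apply: le_trans (hL x) _; rewrite -mulrA ler_wpM2l.
have [K hK] := fin_all_exists h; exists (\sum_i K i).
  by apply: sumr_ge0 => i _; have [] := hK i.
move=> i x; have [Ki0 /(_ x) hi] := hK i; apply: le_trans hi _.
rewrite ler_wpM2r //; first by have [_] := pd_psd (pZ i); apply.
rewrite (bigD1 i) //= lerDl sumr_ge0 // => j _; by have [] := hK j.
Qed.

Lemma sym_qf_eq0 n (Z : 'M[R]_n) :
  Z \is symmetricmx -> (forall x, qf Z x = 0) -> Z = 0.
Proof.
move=> sZ Z0; apply/trmx_inj/row_matrixP => i; rewrite -tr_col trmx0 row0.
have : Z *m delta_mx i (0 : 'I_1) = 0.
  by apply: psd_ker => //; split=> // x; rewrite -/(qf Z x) Z0.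
by rewrite -colE => ->; rewrite trmx0.
Qed.

End QuadraticForms.

(** * Coupled Lyapunov equations *)

Section Lyapunov.
Variables (R : realType) (M n : nat) (r : R) (lam : 'M[R]_M).
Implicit Types (F X Y Z W : 'I_M -> 'M[R]_n).

Definition lyap F X (i : 'I_M) : 'M[R]_n :=
  X i *m F i + (F i)^T *m X i - r *: X i + \sum_j lam i j *: X j.

Lemma lyapD F X Y i : lyap F (fun j => X j + Y j) i = lyap F X i + lyap F Y i.
Proof.
rewrite /lyap mulmxDl mulmxDr scalerDr opprD.
under eq_bigr do rewrite scalerDr.
rewrite big_split /= [RHS]addrACA; congr (_ + _).
by rewrite [RHS]addrACA; congr (_ + _); rewrite addrACA.
Qed.

Lemma lyapZ F a X i : lyap F (fun j => a *: X j) i = a *: lyap F X i.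
Proof.
rewrite /lyap -scalemxAl -scalemxAr !scalerDr scaler_sumr scalerN !scalerA.
rewrite [r * a]mulrC; congr (_ + _); apply: eq_bigr => j _.
by rewrite !scalerA mulrC.
Qed.

Lemma lyapN F X i : lyap F (fun j => - X j) i = - lyap F X i.
Proof.
by rewrite -scaleN1r -lyapZ; congr (lyap F _ i); apply: funext => j;
  rewrite scaleN1r.
Qed.

Lemma lyap_tr F X i : (lyap F X i)^T = lyap F (fun j => (X j)^T) i.
Proof.
have trD (A B : 'M[R]_n) : (A + B)^T = A^T + B^T by exact: linearD.
rewrite /lyap !trD !trmx_mul trmxK [in RHS]addrC [in LHS]addrC.
rewrite [_ *m (X i)^T + _]addrC [(- _)^T]linearN /= [(r *: _)^T]linearZ /=.
congr (_ + _); rewrite [LHS]raddf_sum /=.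
by apply: eq_bigr => j _; rewrite [LHS]linearZ.
Qed.

Lemma lyap_sym F X i :
  (forall j, X j \is symmetricmx) -> lyap F X i \is symmetricmx.
Proof.
move=> sX; apply/symmetricmxP; rewrite lyap_tr; congr (lyap F _ i).
by apply: funext => j; apply/symmetricmxP.
Qed.

Hypothesis hlam : is_generator lam.

(** On the boundary of the positive cone the drift and discount terms vanish
and the coupling terms can only push inwards, because the off-diagonal rates
are nonnegative. *)
Lemma lyap_ker F Z i x :
  (forall j, psdmx (Z j)) -> Z i *m x = 0 -> 0 <= qf (lyap F Z i) x.
Proof.
move=> pZ Zx0; have xZ0 : x^T *m Z i = 0.
  have [/symmetricmxP <- _] := pZ i.
  by rewrite -trmx_mul Zx0 trmx0.
rewrite /lyap !qfD qfN qfZ qf_sum.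
have -> : qf (Z i *m F i) x = 0 by rewrite /qf mulmxA xZ0 !mul0mx mxE.
have -> : qf ((F i)^T *m Z i) x = 0.
  by rewrite /qf -!mulmxA Zx0 !mulmx0 mxE.
have Z0 : qf (Z i) x = 0 by rewrite /qf xZ0 mul0mx mxE.
rewrite Z0 mulr0 oppr0 !add0r (bigD1 i) //= qfZ Z0 mulr0 add0r.
apply: sumr_ge0 => j ji; rewrite qfZ mulr_ge0 //; last by have [_] := pZ j; apply.
by have [h _] := hlam; apply: h; rewrite eq_sym.
Qed.

(** The analogue of a Lyapunov function: it witnesses that the coupled system
with drift F is mean-square stable after discounting at rate r. *)
Definition certificate F Y :=
  (forall i, pdmx (Y i)) /\ forall i x, x != 0 -> qf (lyap F Y i) x < 0.

(** The maximum principle.  The least t >= 0 such that all X(j) + t Y(j) are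
semi-definite exists; if it were positive, one of these forms would be
singular, since otherwise t could be decreased, and a kernel vector of it
would contradict [lyap_ker]. *)
Lemma lyap_psd F Y X : certificate F Y ->
  (forall i, X i \is symmetricmx) ->
  (forall i x, qf (lyap F X i) x <= 0) -> forall i, psdmx (X i).
Proof.
move=> [pY nY] sX nX.
pose Z t j := X j + t *: Y j.
have sZ t j : Z t j \is symmetricmx.
  apply/symmetricmxP; rewrite /Z [LHS]linearD /= [(t *: _)^T]linearZ /=.
  by have [/symmetricmxP -> _] := pY j; have /symmetricmxP -> := sX j.
have qZ t j x : qf (Z t j) x = qf (X j) x + t * qf (Y j) x by rewrite qfD qfZ.
have Y0 j x : 0 <= qf (Y j) x by have [_] := pd_psd (pY j); apply.
pose E : set R := [set t | 0 <= t /\ forall j, psdmx (Z t j)]%classic.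
have E0 : (E !=set0)%classic.
  have [K K0 hK] := qf_dominated (fun i => - X i) pY.
  exists K; split=> // j; split=> // x.
  by rewrite -/(qf _ _) qZ; have := hK j x; rewrite qfN; lra.
have lE : has_lbound E by exists 0 => t [].
set t0 := inf E.
have t0_ge0 : 0 <= t0 by apply: lb_le_inf => // t [].
have Et0 j : psdmx (Z t0 j).
  split=> // x; rewrite -/(qf _ _) qZ leNgt; apply/negP => neg.
  pose e := - (qf (X j) x + t0 * qf (Y j) x) / (qf (Y j) x + 1).
  have q1 : 0 < qf (Y j) x + 1 by rewrite ltr_wpDl.
  have e0 : 0 < e by rewrite divr_gt0 ?oppr_gt0.
  have eE : e * (qf (Y j) x + 1) = - (qf (X j) x + t0 * qf (Y j) x).
    by rewrite mulfVK ?gt_eqF.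
  have [t [_ /(_ j)[_ /(_ x)]]] := inf_adherent e0 (conj E0 lE).
  rewrite -/(qf _ _) -/t0 qZ => h lt_t.
  by have := Y0 j x; nra.
have [t00|t0_neq0] := eqVneq t0 0.
  move=> j; have := Et0 j; rewrite /Z t00 scale0r addr0; exact.
have t0_gt0 : 0 < t0 by rewrite lt_def t0_neq0.
have [pdZ|] := pselect (forall j, pdmx (Z t0 j)).
  have [K K0 hK] := qf_dominated Y pdZ.
  (* the step d satisfies both d <= t0 and K * d <= 1 *)
  pose d := t0 / (1 + K * t0).
  have c0 : 0 < 1 + K * t0 by rewrite ltr_pwDl // mulr_ge0.
  have dE : d * (1 + K * t0) = t0 by rewrite mulfVK ?gt_eqF.
  have d0 : 0 < d by rewrite divr_gt0.
  have Kd0 : 0 <= K * d by rewrite mulr_ge0 // ltW.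
  have dt0 : d <= t0 by nra.
  have Kd1 : K * d <= 1 by rewrite -(ler_pM2r t0_gt0); nra.
  suff /(ge_inf lE) : E (t0 - d) by rewrite -/t0; lra.
  split=> [|j]; first by rewrite subr_ge0.
  split=> // x; rewrite -/(qf _ _) qZ mulrBl.
  have [_ /(_ x)] := Et0 j; have := hK j x; rewrite -/(qf _ _) !qZ.
  set z := _ + _ => yz z0; rewrite addrA -/z subr_ge0.
  apply: le_trans (_ : d * (K * z) <= _); first by rewrite ler_wpM2l // ltW.
  by rewrite mulrA [d * K]mulrC ler_piMl.
move=> /existsNP[j npd]; suff: False by [].
apply: npd; split=> // x x0; rewrite lt_def -/(qf _ _).
have -> : 0 <= qf (Z t0 j) x by have [_] := Et0 j; apply.
rewrite andbT; apply/eqP => /(psd_ker (Et0 j)) Zx0.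
have := lyap_ker F Et0 Zx0.
rewrite lyapD lyapZ qfD qfZ => ge0.
have := nY j x x0; have := nX j x; nra.
Qed.

(** The maximum principle controls L on symmetric tuples only.  Sending the
symmetric part of X to L and keeping its antisymmetric part yields an
endomorphism of all tuples, to which the rank theorem applies without
introducing the subspace of symmetric ones. *)
Definition symlyap F (X : {ffun 'I_M -> 'M[R]_n}) : {ffun 'I_M -> 'M[R]_n} :=
  [ffun i => lyap F (fun j => X j + (X j)^T) i + (X i - (X i)^T)].

Lemma symlyap_linear F : linear (symlyap F).
Proof.
move=> a X Y; apply/ffunP => i; rewrite !ffunE.
have -> : (fun j => (a *: X + Y) j + ((a *: X + Y) j)^T) =
    (fun j => a *: (X j + (X j)^T) + (Y j + (Y j)^T)).
  apply: funext => j; rewrite !ffunE [(_ + Y j)^T]linearD /=.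
  by rewrite [(a *: _)^T]linearZ /= scalerDr addrACA.
rewrite (lyapD F (fun j => a *: (X j + (X j)^T)) (fun j => Y j + (Y j)^T)).
rewrite (lyapZ F a (fun j => X j + (X j)^T))
  [(_ + Y i)^T]linearD /= [(a *: _)^T]linearZ /=.
rewrite opprD [a *: (lyap _ _ _ + _)]scalerDr scalerBr [RHS]addrACA.
by congr (_ + _);
  rewrite addrACA.
Qed.

HB.instance Definition _ F := GRing.isLinear.Build R
  {ffun 'I_M -> 'M[R]_n} {ffun 'I_M -> 'M[R]_n} _ (symlyap F)
  (@symlyap_linear F).

(** By the maximum principle applied to X and - X the operator is injective on
symmetric tuples, hence surjective onto them; applied once more, it shows that
the solution is semi-definite. *)
Lemma lyap_solve F Y W : certificate F Y -> (forall i, psdmx (W i)) ->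
  exists X, (forall i, psdmx (X i)) /\ forall i, lyap F X i = - W i.
Proof.
move=> cY pW.
have trD (A B : 'M[R]_n) : (A + B)^T = A^T + B^T by exact: linearD.
have sS (X : {ffun 'I_M -> 'M[R]_n}) j : (X j + (X j)^T) \is symmetricmx.
  by apply/symmetricmxP; rewrite trD trmxK addrC.
(* symmetric and antisymmetric parts of an equation separate *)
have split_sym (U V : 'M[R]_n) (G : 'M[R]_n) : U^T = U -> V^T = - V -> G^T = G ->
    U + V = G -> U = G /\ V = 0.
  move=> sU sV sG UV; have V0 : V = 0.
    have : (U + V)^T = U + V by rewrite UV.
    rewrite trD sU sV => /addrI/eqP; rewrite eq_sym -addr_eq0 -mulr2n -scaler_nat.
    by rewrite scaler_eq0 pnatr_eq0 => /eqP.
  by rewrite -UV V0 addr0.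
have symP (X : {ffun 'I_M -> 'M[R]_n}) G i : (G i)^T = G i ->
    symlyap F X i = G i ->
    lyap F (fun j => X j + (X j)^T) i = G i /\ X i - (X i)^T = 0.
  move=> sG; rewrite ffunE; apply: split_sym => //.
    by apply/symmetricmxP/lyap_sym.
  by rewrite trD [(- _)^T]linearN /= trmxK opprB addrC.
have lyap_inj X : (forall j, X j \is symmetricmx) ->
    (forall i, lyap F X i = 0) -> forall i, X i = 0.
  move=> sX X0.
  have sNX j : - X j \is symmetricmx.
    by apply/symmetricmxP; rewrite [LHS]linearN /=; have /symmetricmxP -> := sX j.
  have [p1 p2] : (forall i, psdmx (X i)) /\ (forall i, psdmx (- X i)).
    split; apply: lyap_psd cY _ _ => // i x; first by rewrite X0 qf0.
    by rewrite lyapN qfN X0 qf0 oppr0.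
  move=> i; apply: sym_qf_eq0 => // x; apply/le_anti/andP; split.
    by rewrite -oppr_ge0 -qfN; have [_] := p2 i; apply.
  by have [_] := p1 i; apply.
pose f : 'End({ffun 'I_M -> 'M[R]_n}) := linfun (symlyap F).
have f_inj : lker f == 0%VS.
  apply/lker0P => X1 X2; rewrite !lfunE /= => e12.
  apply/eqP; rewrite -subr_eq0; set X := _ - _.
  have e0 i : symlyap F X i = (fun=> 0) i by rewrite /X raddfB /= e12 subrr ffunE.
  have h i := symP X (fun=> 0) i (trmx0 _ _ _) (e0 i).
  have X2_0 := lyap_inj _ (sS X) (fun i => (h i).1).
  apply/eqP/ffunP => i; rewrite [RHS]ffunE; have := X2_0 i.
  have /eqP := (h i).2; rewrite subr_eq0 => /eqP <- /eqP.
  by rewrite -mulr2n -scaler_nat scaler_eq0 pnatr_eq0 => /eqP.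
pose X := (f^-1)%VF [ffun i => - W i].
have fX : symlyap F X = [ffun i => - W i].
  by rewrite -[RHS](lker0_lfunVK f_inj) lfunE.
have LX i : lyap F (fun j => X j + (X j)^T) i = - W i.
  have [] // := symP X (fun i => - W i) i; last by rewrite fX ffunE.
  by rewrite [LHS]linearN /=; have [/symmetricmxP -> _] := pW i.
exists (fun j => X j + (X j)^T); split=> //.
apply: lyap_psd cY _ _ => // i x.
by rewrite LX qfN oppr_le0; have [_] := pW i; apply.
Qed.

End Lyapunov.

(** * Limits of matrix sequences *)

Section MatrixLimits.
Variable R : realType.
Local Open Scope classical_set_scope.

(** Convergence is taken entrywise, so that rules for sums and products reduce
to those for real sequences. *)
Definition mcvg m n (U : nat -> 'M[R]_(m, n)) (V : 'M[R]_(m, n)) : Prop :=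
  forall a b, U k a b @[k --> \oo] --> V a b.

Lemma mcvg_cst m n (V : 'M[R]_(m, n)) : mcvg (fun=> V) V.
Proof. by move=> a b; apply: cvg_cst. Qed.
Arguments mcvg_cst {m n} V.

Lemma mcvgD m n (U1 U2 : nat -> 'M[R]_(m, n)) V1 V2 :
  mcvg U1 V1 -> mcvg U2 V2 -> mcvg (fun k => U1 k + U2 k) (V1 + V2).
Proof.
move=> h1 h2 a b; rewrite mxE.
under eq_fun do rewrite mxE; exact: cvgD (h1 a b) (h2 a b).
Qed.

Lemma mcvgZ m n (c : R) (U : nat -> 'M[R]_(m, n)) V :
  mcvg U V -> mcvg (fun k => c *: U k) (c *: V).
Proof.
move=> h a b; rewrite mxE.
under eq_fun do rewrite mxE; exact: cvgM (cvg_cst c) (h a b).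
Qed.

Lemma mcvgN m n (U : nat -> 'M[R]_(m, n)) V :
  mcvg U V -> mcvg (fun k => - U k) (- V).
Proof.
move=> h a b; rewrite mxE.
under eq_fun do rewrite mxE; exact: cvgN (h a b).
Qed.

Lemma mcvg_tr m n (U : nat -> 'M[R]_(m, n)) V :
  mcvg U V -> mcvg (fun k => (U k)^T) V^T.
Proof. move=> h a b; rewrite mxE; under eq_fun do rewrite mxE; exact: h. Qed.

Lemma mcvg_sum m n (I : finType) (U : I -> nat -> 'M[R]_(m, n)) V :
  (forall i, mcvg (U i) (V i)) ->
  mcvg (fun k => \sum_i U i k) (\sum_i V i).
Proof.
move=> h a b; rewrite summxE; under eq_fun do rewrite summxE.
by apply: cvg_big => [|i _]; [exact: add_continuous | exact: h].
Qed.

Lemma mcvgM m n p (U1 : nat -> 'M[R]_(m, n)) (U2 : nat -> 'M[R]_(n, p)) V1 V2 :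
  mcvg U1 V1 -> mcvg U2 V2 -> mcvg (fun k => U1 k *m U2 k) (V1 *m V2).
Proof.
move=> h1 h2 a b; rewrite mxE; under eq_fun do rewrite mxE.
apply: cvg_big => [|i _]; first exact: add_continuous.
exact: cvgM (h1 a i) (h2 i b).
Qed.

Lemma mcvg_shiftS m n (U : nat -> 'M[R]_(m, n)) V :
  mcvg U V -> mcvg (fun k => U k.+1) V.
Proof. by move=> h a b; have := h a b; rewrite -cvg_shiftS. Qed.

Lemma mcvg_unique m n (U : nat -> 'M[R]_(m, n)) V1 V2 :
  mcvg U V1 -> mcvg U V2 -> V1 = V2.
Proof.
move=> h1 h2; apply/matrixP => a b.
exact: cvg_unique (h1 a b) (h2 a b).
Qed.

Lemma qf_cvg n (U : nat -> 'M[R]_n) V x :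
  mcvg U V -> qf (U k) x @[k --> \oo] --> qf V x.
Proof.
by move=> h; have := mcvgM (mcvgM (mcvg_cst x^T) h) (mcvg_cst x); apply.
Qed.

Lemma mcvg_psd n (U : nat -> 'M[R]_n) V :
  (forall k, psdmx (U k)) -> mcvg U V -> psdmx V.
Proof.
move=> pU UV; split=> [|x].
  apply/symmetricmxP/(mcvg_unique (U := U)) => //.
  have -> : U = fun k => (U k)^T; last exact: mcvg_tr.
  by apply: funext => k; have [/symmetricmxP ->] := pU k.
apply: (closed_cvg (fun t : R => 0 <= t)) (qf_cvg (x := x) UV).
  exact: closed_ge.
by near=> k; have [_] := pU k; apply.
Unshelve. all: by end_near. Qed.

(** Each value of the form is a nonincreasing sequence of nonnegative reals,
and polarization expresses the entries by three such values. *)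
Lemma psd_decreasing_cvg n (U : nat -> 'M[R]_n) :
  (forall k, psdmx (U k)) -> (forall k x, qf (U k.+1) x <= qf (U k) x) ->
  exists V, mcvg U V.
Proof.
move=> pU dU.
have cq x : cvgn (fun k => qf (U k) x).
  apply: nonincreasing_is_cvgn; first by apply/nonincreasing_seqP => k.
  by exists 0 => _ [k _ <-]; have [_] := pU k; apply.
pose e a : 'cV[R]_n := delta_mx a 0.
have Ue k a b : U k a b =
    2^-1 * (qf (U k) (e a + e b) - qf (U k) (e a) - qf (U k) (e b)).
  have [sU _] := pU k; rewrite qfDvec //.
  transitivity (((e b)^T *m U k *m e a) 0 0); last by field.
  rewrite trmx_delta -rowE -colE !mxE.
  by have /symmetricmxP {1}<- := sU; rewrite mxE.
exists (\matrix_(a, b) (2^-1 * (limn (fun k => qf (U k) (e a + e b))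
  - limn (fun k => qf (U k) (e a)) - limn (fun k => qf (U k) (e b))))).
move=> a b; rewrite mxE; under eq_fun do rewrite Ue.
by apply: cvgM; [exact: cvg_cst | apply: cvgB; [apply: cvgB|]; exact: cq].
Qed.

End MatrixLimits.
Arguments mcvg_cst {R m n} V.
Arguments mcvgZ {R m n} c {U V}.

(** * Policy iteration *)

Section PolicyIteration.
Variables (R : realType) (M n k : nat) (r : R) (lam : 'M[R]_M).
Variables (A C Q P : 'I_M -> 'M[R]_n) (B D : 'I_M -> 'M[R]_(n, k)).
Variable Rw : 'I_M -> 'M[R]_k.
Implicit Types (X : 'I_M -> 'M[R]_n) (T : 'I_M -> 'M[R]_(k, n)).

Let trD m p (U V : 'M[R]_(m, p)) : (U + V)^T = U^T + V^T.
Proof. exact: linearD. Qed.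

(** The closed-loop drift A + B T under the feedback u = T x. *)
Definition drift T i := A i + B i *m T i.

(** The running cost of the feedback u = T x, in which the quadratic form P
acts on the closed-loop diffusion C + D T. *)
Definition cost T i : 'M[R]_n :=
  (C i + D i *m T i)^T *m P i *m (C i + D i *m T i) + Q i
  + (T i)^T *m Rw i *m T i.

(** The residual of X as the expected discounted cost of the policy T. *)
Definition bellman T X i := lyap r lam (drift T) X i + cost T i.

(** The minimizer of T |-> [bellman T X]. *)
Definition gain X i := - (invmx (Rtilde D Rw P i) *m Smx B C D P X i).

Lemma complete_square (S T : 'M[R]_(k, n)) (G : 'M[R]_k) :
  G \is symmetricmx -> G \in unitmx ->
  T^T *m S + S^T *m T + T^T *m G *m T =
  (T + invmx G *m S)^T *m G *m (T + invmx G *m S) - S^T *m invmx G *m S.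
Proof.
move=> /symmetricmxP sG uG.
rewrite trD trmx_mul trmx_inv sG [(_ + _) *m G]mulmxDl mulmxKV //.
rewrite !(mulmxDl, mulmxDr) !mulmxA mulmxK //.
move: (T^T *m S) (S^T *m T) (T^T *m G *m T) (S^T *m invmx G *m S) => *.
by apply/matrixP => a b; rewrite !mxE; ring.
Qed.

Lemma gain_cvg (X : nat -> 'I_M -> 'M[R]_n) V :
  (forall j, mcvg (X ^~ j) (V j)) ->
  forall i, mcvg (fun m => gain (X m) i) (gain V i).
Proof.
move=> XV i; exact: (mcvgN (mcvgM (mcvg_cst (invmx (Rtilde D Rw P i)))
  (mcvgD (mcvgM (mcvg_cst (B i)^T) (XV i))
    (mcvg_cst ((D i)^T *m P i *m C i))))).
Qed.

Lemma bellman_cvg (T : nat -> 'I_M -> 'M[R]_(k, n))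
    (X : nat -> 'I_M -> 'M[R]_n) S V :
  (forall j, mcvg (T ^~ j) (S j)) -> (forall j, mcvg (X ^~ j) (V j)) ->
  forall i, mcvg (fun m => bellman (T m) (X m) i) (bellman S V i).
Proof.
move=> TS XV i.
have dS : mcvg (fun m => drift (T m) i) (drift S i).
  exact: (mcvgD (mcvg_cst (A i)) (mcvgM (mcvg_cst (B i)) (TS i))).
have oS : mcvg (fun m => C i + D i *m T m i) (C i + D i *m S i).
  exact: (mcvgD (mcvg_cst (C i)) (mcvgM (mcvg_cst (D i)) (TS i))).
have coupling := mcvg_sum (fun j => mcvgZ (lam i j) (XV j)).
apply: mcvgD.
  exact: (mcvgD (mcvgD (mcvgD (mcvgM (XV i) dS) (mcvgM (mcvg_tr dS) (XV i)))
    (mcvgN (mcvgZ r (XV i)))) coupling).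
exact: (mcvgD (mcvgD (mcvgM (mcvgM (mcvg_tr oS) (mcvg_cst (P i))) oS)
    (mcvg_cst (Q i)))
  (mcvgM (mcvgM (mcvg_tr (TS i)) (mcvg_cst (Rw i))) (TS i))).
Qed.

Hypothesis pP : forall i, psdmx (P i).
Hypothesis pQ : forall i, psdmx (Q i).
Hypothesis pRw : forall i, psdmx (Rw i).
Hypothesis pRt : forall i, pdmx (Rtilde D Rw P i).

(** The quadratic term in T collects R from the cost and D^T P D from the
diffusion into R~, and the linear one collects the two halves of S~. *)
Lemma bellmanE T X i : X i \is symmetricmx ->
  bellman T X i = lyap r lam A X i + (C i)^T *m P i *m C i + Q i
    + ((T i)^T *m Smx B C D P X i + (Smx B C D P X i)^T *m T i
       + (T i)^T *m Rtilde D Rw P i *m T i).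
Proof.
move=> /symmetricmxP sX; have [/symmetricmxP sP _] := pP i.
rewrite /bellman /cost /lyap /drift /Smx /Rtilde.
rewrite !(trD, trmx_mul, trmxK, sX, sP) !(mulmxDl, mulmxDr) !mulmxA.
move: (\sum_j _) (r *: _) => s rX.
move: (X i *m A i) (X i *m B i *m T i) ((A i)^T *m X i) ((C i)^T *m P i *m C i)
  ((T i)^T *m (B i)^T *m X i) ((C i)^T *m P i *m D i *m T i)
  ((T i)^T *m (D i)^T *m P i *m C i) ((T i)^T *m (D i)^T *m P i *m D i *m T i)
  ((T i)^T *m Rw i *m T i).
move=> *; apply/matrixP => a b; rewrite !mxE; ring.
Qed.

Lemma bellman_square T X i : X i \is symmetricmx ->
  bellman T X i = bellman (gain X) X i
    + (T i - gain X i)^T *m Rtilde D Rw P i *m (T i - gain X i).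
Proof.
move=> sX; have [sR _] := pRt i; have uR := pd_unit (pRt i).
rewrite !bellmanE // !complete_square // /gain opprK addNr mulmx0 add0r.
by rewrite -[RHS]addrA [X in _ = _ + X]addrC.
Qed.

Lemma bellman_riccati X : (forall i, X i \is symmetricmx) ->
  (forall i, bellman (gain X) X i = 0) ->
  riccati_system_tilde r lam A C Q B D Rw P X.
Proof.
move=> sX X0 i; have [sR _] := pRt i; have uR := pd_unit (pRt i).
have := X0 i; rewrite bellmanE // complete_square // /gain addNr mulmx0 add0r.
rewrite /lyap => h; apply/eqP; rewrite -subr_eq0 -oppr_eq0; apply/eqP.
rewrite -[RHS]h; move: (\sum_j _) (r *: _) (X i *m _) ((A i)^T *m _) (_ *m C i)
  (_ *m Smx B C D P X i) => *.
by apply/matrixP => a b; rewrite !mxE; ring.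
Qed.

Lemma cost_psd T i : psdmx (cost T i).
Proof.
by apply: psdD (psd_congr _ (pRw i)); apply: psdD (psd_congr _ (pP i)) _.
Qed.

Hypothesis hlam : is_generator lam.
Hypothesis pA : forall i, pdmx (r%:M - (A i + (A i)^T)).

(** The invariant of the iteration.  The margin e leaves room for X to be a
certificate although Q is only semi-definite. *)
Definition supersolution (e : R) X :=
  (forall i, psdmx (X i)) /\
  forall i x, qf (bellman (gain X) X i) x <= - (e * qf 1%:M x).

(** The cost being nonnegative, the margin makes L(X) strictly negative; by
[lyap_ker] this also prevents X from being singular. *)
Lemma supersolution_certificate e X : 0 < e -> supersolution e X ->
  certificate r lam (drift (gain X)) X.
Proof.
move=> e0 [pX nX].
have nL i x : x != 0 -> qf (lyap r lam (drift (gain X)) X i) x < 0.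
  move=> /qf1_gt0 x0; have := nX i x; rewrite qfD => h.
  have := mulr_gt0 e0 x0.
  by have [_ /(_ x)] := cost_psd (gain X) i; rewrite -/(qf _ _); lra.
split=> // i; have [sX _] := pX i; split=> // x x0.
rewrite lt_def -/(qf _ _); apply/andP; split; last by have [_] := pX i; apply.
apply/eqP => /(psd_ker (pX i)) /(lyap_ker r hlam (drift (gain X)) pX).
by rewrite leNgt nL.
Qed.

Lemma evaluate_policy T Y e : certificate r lam (drift T) Y -> 0 <= e ->
  exists X, (forall i, psdmx (X i)) /\ forall i, bellman T X i = - e%:M.
Proof.
move=> cY e0.
have pW i : psdmx (cost T i + e%:M) := psdD (cost_psd T i) (psd_scalar n e0).
have [X [pX eX]] := lyap_solve hlam cY pW; exists X; split=> // i.
by rewrite /bellman eX opprD addrAC addNr add0r.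
Qed.

(** The gain of X does at least as well as the gain T that X was computed from. *)
Lemma supersolution_of_policy T X e : (forall i, psdmx (X i)) ->
  (forall i, bellman T X i = - e%:M) -> supersolution e X.
Proof.
move=> pX eX; split=> // i x.
have [sX _] := pX i; have := bellman_square T sX; rewrite eX.
move=> /(congr1 (fun Z => qf Z x)); rewrite qfN qf_scalar qfD qf_congr => ->.
by rewrite lerDl; have [_] := pd_psd (pRt i); apply.
Qed.

Lemma supersolution_init e : 0 <= e -> exists X, supersolution e X.
Proof.
move=> e0; have c0 : certificate r lam (drift (fun=> 0)) (fun=> 1%:M).
  split=> [i|i x x0].
    split=> [|x]; first by apply/symmetricmxP; rewrite tr_scalar_mx.
    by rewrite -/(qf _ _); exact: qf1_gt0.
  rewrite /lyap /drift mulmx0 addr0 mul1mx mulmx1 -scaler_suml.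
  have [_ ->] := hlam; rewrite scale0r addr0 scale_scalar_mx mulr1.
  by have [_ /(_ x x0)] := pA i; rewrite -/(qf _ _) !(qfD, qfN); lra.
have [X [pX eX]] := evaluate_policy c0 e0.
by exists X; apply: supersolution_of_policy pX eX.
Qed.

(** X is a certificate for its own gain, so that the cost X' of this gain,
increased by e' I, exists; X - X' >= 0 by the maximum principle because e' <= e. *)
Lemma policy_improvement e e' X : 0 < e -> 0 <= e' -> e' <= e ->
  supersolution e X ->
  exists X', [/\ supersolution e' X', forall i x, qf (X' i) x <= qf (X i) x &
    forall i, bellman (gain X) X' i = - e'%:M].
Proof.
move=> e0 e'0 le_e sX; have cX := supersolution_certificate e0 sX.
have [X' [pX' eX']] := evaluate_policy cX e'0.
exists X'; split=> //; first exact: supersolution_of_policy pX' eX'.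
have [pX nX] := sX.
suff pXX' : forall i, psdmx (X i - X' i).
  move=> i x; have [_ /(_ x)] := pXX' i.
  by rewrite -/(qf _ _) qfD qfN subr_ge0.
apply: (lyap_psd hlam cX) => [i|i x].
  have [/symmetricmxP s1 _] := pX i; have [/symmetricmxP s2 _] := pX' i.
  by apply/symmetricmxP; rewrite trD [(- _)^T]linearN /= s1 s2.
rewrite (lyapD r lam _ X (fun j => - X' j)) lyapN qfD qfN.
have := nX i x; have := congr1 (fun Z => qf Z x) (eX' i).
have qE Y : qf (bellman (gain X) Y i) x =
    qf (lyap r lam (drift (gain X)) Y i) x + qf (cost (gain X) i) x by exact: qfD.
rewrite !qE qfN qf_scalar.
have := mulr_ge0 (_ : 0 <= e - e') (qf1_ge0 x); rewrite subr_ge0 => /(_ le_e).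
lra.
Qed.

(** The margins are e_m = 1 / (m + 1).  The iterates X_m decrease to a limit V,
and [bellman (gain X_m) X_(m+1)] = - e_(m+1) I passes to the limit. *)
Lemma riccati_tilde_solvable : exists X, (forall i, psdmx (X i)) /\
  riccati_system_tilde r lam A C Q B D Rw P X.
Proof.
pose e m : R := harmonic m.
have e_gt0 m : 0 < e m by exact: harmonic_gt0.
have e_decr m : e m.+1 <= e m.
  by rewrite /e /harmonic /= lef_pV2 ?posrE ?ltr0n // ler_nat.
(* outside the invariant the successor is irrelevant; defining it there makes
   the step total, so that a choice function exists *)
have step (mX : nat * ('I_M -> 'M[R]_n)) : exists X',
    supersolution (e mX.1) mX.2 ->
    [/\ supersolution (e mX.1.+1) X', forall i x, qf (X' i) x <= qf (mX.2 i) x &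
      forall i, bellman (gain mX.2) X' i = - (e mX.1.+1)%:M].
  have [s|ns] := pselect (supersolution (e mX.1) mX.2); last by exists mX.2.
  have [X' hX'] := policy_improvement (e_gt0 _) (ltW (e_gt0 _)) (e_decr _) s.
  by exists X'.
have [next nextP] := choice step.
have [X0 sX0] := supersolution_init (ltW (e_gt0 0)).
pose X := fix X m := if m is m'.+1 then next (m', X m') else X0.
have sX m : supersolution (e m) (X m).
  by elim: m => //= m IH; have [] := nextP (m, X m) IH.
have XS m := nextP (m, X m) (sX m).
have h i : exists V, mcvg (X ^~ i) V.
  apply: psd_decreasing_cvg => [m|m x]; first by have [] := sX m.
  by have [_ + _] := XS m; apply.
have [V XV] := fin_all_exists h.
have pV i : psdmx (V i) by apply: mcvg_psd (XV i) => m; have [] := sX m.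
exists V; split=> //; apply: bellman_riccati => i; first by have [] := pV i.
have gV j : mcvg (fun m => gain (X m) j) (gain V j).
  exact: gain_cvg.
apply: (mcvg_unique (U := fun m => bellman (gain (X m)) (X m.+1) i)).
  by apply: bellman_cvg => // j; exact: (mcvg_shiftS (XV j)).
have -> : (fun m => bellman (gain (X m)) (X m.+1) i) = (fun m => - (e m.+1)%:M).
  by apply: funext => m; have [_ _ ->] := XS m.
rewrite -oppr0; apply: mcvgN => a b; rewrite mxE; under eq_fun do rewrite mxE.
case: (a == b) => /=; last exact: cvg_cst.
by have := @cvg_harmonic R; rewrite -cvg_shiftS; apply.
Qed.

End PolicyIteration.

(** * The second Riccati system *)

Theorem theorem5p3 (R : realType) (M n k : nat) (r : R) (lam : 'M[R]_M)
    (A Ah C Ch Q Qh : 'I_M -> 'M[R]_n) (B D : 'I_M -> 'M[R]_(n, k))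
    (Rw : 'I_M -> 'M[R]_k) (P : 'I_M -> 'M[R]_n)
    (hr : 0 < r)
    (hlam : is_generator lam)
    (hAC : forall i : 'I_M,
       pdmx (r%:M - (A i + (A i)^T + (C i)^T *m C i)))
    (hAAh : forall i : 'I_M,
       pdmx (r%:M - (A i + (A i)^T + Ah i + (Ah i)^T)))
    (hQ : forall i : 'I_M, psdmx (Q i))
    (hQh : forall i : 'I_M, psdmx (Qh i))
    (hR : forall i : 'I_M, pdmx (Rw i))
    (hPpsd : forall i : 'I_M, psdmx (P i))
    (hP : riccati_system r lam A C Q B D Rw P) :
  exists Pt : 'I_M -> 'M[R]_n,
    (forall i : 'I_M, psdmx (Pt i)) /\
    riccati_system_tilde r lam
      (fun i => A i + Ah i) (fun i => C i + Ch i) (fun i => Q i + Qh i)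
      B D Rw P Pt.
Proof.
apply: riccati_tilde_solvable => // i.
- exact: psdD.
- exact: pd_psd.
- by have [] := hP i.
- have -> : A i + Ah i + (A i + Ah i)^T = A i + (A i)^T + Ah i + (Ah i)^T.
    by rewrite [(_ + _)^T]linearD /= addrACA addrA.
  exact: hAAh.
Qed.
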